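(* Let $n\ge 1$ be an integer, let $T>0$ and $a>0$, and let $\alpha\in(-\infty,-\frac n2]$. Then the function $$u_\alpha(t,x)=a\,(T-t)^{\alpha}\sum_{s=0}^{\infty}\frac{(-\alpha)_s}{(\frac n2)_s}\,\frac{1}{s!}\left(\frac{|x|^2}{4(T-t)}\right)^{s}$$ is a self-similar solution of type II, in $(0,T)\times\mathbb{R}^n$, of the heat equation $u_t=\Delta u$, and it blows up at the finite time $T$.
   Context: For real $c$, $(c)_0=1$ and $(c)_s=c(c+1)\cdots(c+s-1)$ for integers $s\ge1$ (Pochhammer symbol). A self-similar solution of type II of the heat equation is a solution of the form $u(t,x)=(T-t)^{\alpha}v(x(T-t)^{\beta})$ with $\beta=-\frac12$, where $v>0$ is a (radially symmetric) function on $\mathbb{R}^n$. A classical solution $u$ blows up at time $T<\infty$ if $\lim_{t\uparrow T}\sup_{x\in\mathbb{R}^n}|u(t,x)|=\infty$ (the supremum being taken in $[0,\infty]$). *)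

(* Defs.v *)
From HB Require Import structures.
From mathcomp Require Import all_boot all_order all_algebra.
From mathcomp Require Import all_classical all_reals all_analysis.
Set Implicit Arguments.
Unset Strict Implicit.
Unset Printing Implicit Defensive.
Import Order.TTheory GRing.Theory Num.Theory.
Import numFieldNormedType.Exports.
Local Open Scope classical_set_scope.
Local Open Scope ring_scope.

Definition pochhammer {R : realType} (c : R) (s : nat) : R :=
  \prod_(i < s) (c + i%:R).

(* The library's `|x| on row vectors is the sup norm (it induces the same
   topology), hence a separate Euclidean norm. *)
Definition enorm {R : realType} {n : nat} (x : 'rV[R]_n) : R :=
  Num.sqrt (\sum_(i < n) x 0 i ^+ 2).

Definition dt {R : realType} {n : nat} (u : R -> 'rV[R]_n -> R) :
    R -> 'rV[R]_n -> R :=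
  fun t x => 'D_1 (fun s => u s x) t.

Definition dx {R : realType} {n : nat} (i : 'I_n) (u : R -> 'rV[R]_n -> R) :
    R -> 'rV[R]_n -> R :=
  fun t x => 'D_(delta_mx 0 i) (u t) x.

Definition laplacian {R : realType} {n : nat} (u : R -> 'rV[R]_n -> R) :
    R -> 'rV[R]_n -> R :=
  fun t x => \sum_(i < n) dx i (dx i u) t x.

(* Since (0,T) x R^n is open, continuity at each of its points, in the two
   variables jointly, is continuity on it. *)
Definition continuous_on_strip {R : realType} {n : nat} (T : R)
    (u : R -> 'rV[R]_n -> R) : Prop :=
  forall (t : R) (x : 'rV[R]_n), 0 < t < T ->
    {for (t, x), continuous (fun p : R * 'rV[R]_n => u p.1 p.2)}.

(* C^1 in t and C^2 in x: 'D_v is a total operator with a junk value where the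
   limit fails to exist, so existence of the derivatives is required too. *)
Record C12_on_strip {R : realType} {n : nat} (T : R)
    (u : R -> 'rV[R]_n -> R) : Prop := {
  C12_derivable_t : forall (t : R) (x : 'rV[R]_n), 0 < t < T -> derivable (fun s => u s x) t 1;
  C12_derivable_x : forall (t : R) (x : 'rV[R]_n) (i : 'I_n),
    0 < t < T ->
    derivable (u t) x (delta_mx 0 i);
  C12_derivable_xx : forall (t : R) (x : 'rV[R]_n) (i j : 'I_n),
    0 < t < T ->
    derivable (dx j u t) x (delta_mx 0 i);
  C12_cont : continuous_on_strip T u;
  C12_cont_t : continuous_on_strip T (dt u);
  C12_cont_x : forall i, continuous_on_strip T (dx i u);
  C12_cont_xx : forall i j, continuous_on_strip T (dx i (dx j u)) }.

Definition classical_heat_solution {R : realType} {n : nat} (T : R)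
    (u : R -> 'rV[R]_n -> R) : Prop :=
  C12_on_strip T u /\
  forall (t : R) (x : 'rV[R]_n), 0 < t < T -> dt u t x = laplacian u t x.

Definition radially_symmetric {R : realType} {n : nat} (v : 'rV[R]_n -> R) :
    Prop :=
  forall x y, enorm x = enorm y -> v x = v y.

Definition selfsimilar_typeII_solution {R : realType} {n : nat} (alpha T : R)
    (u : R -> 'rV[R]_n -> R) : Prop :=
  classical_heat_solution T u /\
  exists v : 'rV[R]_n -> R,
    [/\ forall y, 0 < v y,
        radially_symmetric v &
        forall (t : R) (x : 'rV[R]_n), 0 < t < T ->
          u t x = (T - t) `^ alpha * v ((T - t) `^ (- (1 / 2)) *: x)].

Definition blows_up_at {R : realType} {n : nat} (T : R)
    (u : R -> 'rV[R]_n -> R) : Prop :=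
  ereal_sup [set `|u t x|%:E | x in [set: 'rV[R]_n]] @[t --> T^'-] --> +oo%E.

Definition u_series {R : realType} (n : nat) (alpha T : R) (t : R)
    (x : 'rV[R]_n) : R^nat :=
  fun s => pochhammer (- alpha) s / pochhammer (n%:R / 2) s * (s`!%:R)^-1
           * (enorm x ^+ 2 / (4 * (T - t))) ^+ s.

Definition u_alpha {R : realType} (n : nat) (a alpha T : R) (t : R)
    (x : 'rV[R]_n) : R :=
  a * (T - t) `^ alpha * limn (series (u_series alpha T t x)).

(* Main.v *)
Require Import Defs.
From HB Require Import structures.
From mathcomp Require Import all_boot all_order all_algebra.
From mathcomp Require Import all_classical all_reals all_analysis.
From mathcomp Require Import ring.
Import Order.TTheory GRing.Theory Num.Theory.
Import numFieldNormedType.Exports.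
Local Open Scope classical_set_scope.
Local Open Scope ring_scope.

(** Put A = - alpha and b = n/2, and let M(z) be the power series with
coefficients (A)_s / ((b)_s s!), so that u = a (T - t)^alpha M(z) with
z = |x|^2 / (4 (T - t)). Since 0 < b <= A, the coefficients are at most
(A / b)^s / s! (kummer_coef_bounded). Hence the series converges everywhere and
may be differentiated termwise as often as needed (is_derive_psum).

The chain rule turns the two sides of the heat equation into
a (T - t)^(alpha - 1) times A M + z M' for the time derivative and
z M'' + b M' for the Laplacian (heat_similarity_fun). These agree because M
solves Kummer's equation, which is the recurrence
(b + s) (s + 1) c_(s+1) = (A + s) c_s between its coefficients c
(psum_kummer_ode, kummer_coef_rec). The C^(1,2) regularity is read off the
explicit formulas for the derivatives (C12_similarity_fun).

The profile of the self-similar form is v(y) = a M(|y|^2 / 4). It is positive, in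
fact at least a, because M has nonnegative coefficients and constant term 1
(psum_ge1). At the origin this gives u(t, 0) >= a (T - t)^alpha, and alpha < 0, so
the supremum over x tends to infinity as t increases to T (powR_blowup). *)

(** * Power series with coefficients of exponential type *)

Definition psum {R : realType} (c : R^nat) (z : R) : R := limn (pseries c z).

(** Domination by the coefficients of C * exp (q z): the sum is then entire, and
the property survives termwise differentiation. *)
Definition exp_bounded {R : realType} (c : R^nat) : Prop :=
  exists C q : R,
    [/\ 0 <= C, 0 <= q & forall s, `|c s| <= C * (q ^+ s / s`!%:R)].

(** With d the differentiated coefficients, |d_s| = (s+1) |c_(s+1)| is at most
(C q) q^s / s!, so only the constant changes. *)
Lemma exp_bounded_diffs {R : realType} {c : R^nat} :
  exp_bounded c -> exp_bounded (pseries_diffs c).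
Proof.
move=> [C [q [C0 q0 cle]]]; exists (C * q), q.
split=> //; first exact: mulr_ge0.
move=> s; rewrite /pseries_diffs normrM ger0_norm//.
apply: (le_trans (ler_wpM2l _ (cle s.+1))) => //.
rewrite factS natrM exprS.
have s0 : s.+1%:R != 0 :> R by rewrite pnatr_eq0.
have f0 : s`!%:R != 0 :> R by rewrite pnatr_eq0 -lt0n fact_gt0.
rewrite le_eqVlt; apply/orP; left; apply/eqP; field; exact/andP.
Qed.

Lemma exp_bounded_cvg {R : realType} {c : R^nat} (z : R) :
  exp_bounded c -> cvgn (pseries c z).
Proof.
move=> [C [q [C0 q0 cle]]]; apply: normed_cvg.
apply: (@series_le_cvg R _ (C *: exp_coeff (q * `|z|))).
- by move=> s /=.
- move=> s; apply: mulr_ge0 => //.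
  by rewrite /exp_coeff divr_ge0// exprn_ge0// mulr_ge0.
- move=> s /=; rewrite normrM normrX.
  rewrite [leRHS](_ : _ = C * ((q * `|z|) ^+ s / s`!%:R))//.
  by rewrite exprMn mulrAC mulrA ler_wpM2r ?exprn_ge0.
- exact/is_cvg_seriesZ/is_cvg_series_exp_coeff.
Qed.

(** Termwise differentiation at z needs the series, its derivative and its
second derivative to converge at a point further out than z; these three are
all of exponential type, so |z| + 1 serves. *)
Lemma is_derive_psum {R : realType} (c : R^nat) (z : R) : exp_bounded c ->
  is_derive z 1 (psum c) (psum (pseries_diffs c) z).
Proof.
move=> hc; apply: (@pseries_snd_diffs _ _ (`|z| + 1)).
- exact: exp_bounded_cvg.
- exact/exp_bounded_cvg/exp_bounded_diffs.
- exact/exp_bounded_cvg/exp_bounded_diffs/exp_bounded_diffs.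
- by rewrite [ltRHS]ger0_norm ?addr_ge0// ltrDl.
Qed.

Lemma continuous_psum {R : realType} (c : R^nat) : exp_bounded c ->
  continuous (psum c).
Proof.
move=> hc z; apply/differentiable_continuous/derivable1_diffP.
by have [] := is_derive_psum c z hc.
Qed.

(** The Euler operator z d/dz acts on coefficients by c_s |-> s c_s. *)
Lemma pseries_euler {R : realType} (c : R^nat) (z : R) : exp_bounded c ->
  pseries (fun s => s%:R * c s) z @ \oo --> z * psum (pseries_diffs c) z.
Proof.
move=> hc.
have /pseries_diffs_equiv h := exp_bounded_cvg z (exp_bounded_diffs hc).
suff -> : pseries (fun s => s%:R * c s) z =
    (fun N => z * series (fun i => i%:R * c i * z ^+ i.-1) N).
  exact: cvgM (cvg_cst z) h.
apply/funext => N; rewrite /pseries /series /= mulr_sumr.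
apply: eq_bigr => -[|s] _ /=.
  by rewrite !mul0r mulr0.
by rewrite exprS; ring.
Qed.

(** Kummer's equation z M'' + (b - z) M' - A M = 0, with the terms split so that
each side is one power series: by the Euler operator the left-hand side has
coefficients (b + s) d_s, where d are the coefficients of M', and the right-hand
side has coefficients (A + s) c_s. The recurrence says that they agree. *)
Lemma psum_kummer_ode {R : realType} (A b : R) (c : R^nat) (z : R) :
    exp_bounded c ->
    (forall s, (b + s%:R) * pseries_diffs c s = (A + s%:R) * c s) ->
  let d := pseries_diffs c in
  z * psum (pseries_diffs d) z + b * psum d z = A * psum c z + z * psum d z.
Proof.
move=> hc rec d.
have hd : exp_bounded d := exp_bounded_diffs hc.
have step (B : R) (e : R^nat) : exp_bounded e ->
    pseries (fun s => (B + s%:R) * e s) z @ \oo -->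
      B * psum e z + z * psum (pseries_diffs e) z.
  move=> he.
  suff -> : pseries (fun s => (B + s%:R) * e s) z =
      (fun N => B * pseries e z N + pseries (fun s => s%:R * e s) z N).
    apply: cvgD; last exact: pseries_euler.
    exact: cvgM (cvg_cst B) (exp_bounded_cvg z he).
  apply/funext => N; rewrite /pseries /series /= mulr_sumr -big_split /=.
  by apply: eq_bigr => s _; ring.
have h1 := step b d hd; have h2 := step A c hc.
rewrite addrC -(cvg_lim _ h1)// -(cvg_lim _ h2)//.
congr (limn (pseries _ _)); exact/funext.
Qed.

(** For nonnegative terms the partial sums increase from the first one, which
is 1. This gives both the positivity of the profile and the lower bound for the
blow-up. *)
Lemma psum_ge1 {R : realType} (c : R^nat) (z : R) : exp_bounded c ->
  c 0%N = 1 -> (forall s, 0 <= c s) -> 0 <= z -> 1 <= psum c z.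
Proof.
move=> hc c0 cge z0.
have h := nondecreasing_cvgn_le _ (exp_bounded_cvg z hc) 1%N.
apply: le_trans (h _); last first.
  apply/nondecreasing_seqP => N; rewrite /pseries !seriesEnat /=.
  by rewrite big_nat_recr//= lerDl mulr_ge0// exprn_ge0.
by rewrite /pseries seriesEnat /= big_nat1 c0 expr0 mulr1.
Qed.

(** * The coefficients of Kummer's function *)

(** Coefficients of the confluent hypergeometric function M(A, b, z). *)
Definition kummer_coef {R : realType} (A b : R) (s : nat) : R :=
  pochhammer A s / pochhammer b s * (s`!%:R)^-1.

Lemma pochhammerS {R : realType} (c : R) s :
  pochhammer c s.+1 = pochhammer c s * (c + s%:R).
Proof. by rewrite /pochhammer big_ord_recr. Qed.

Lemma pochhammer_gt0 {R : realType} (c : R) s : 0 < c -> 0 < pochhammer c s.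
Proof. by move=> c0; apply: prodr_gt0 => i _; apply: ltr_pwDl. Qed.

Lemma kummer_coef_ge0 {R : realType} (A b : R) s : 0 < A -> 0 < b ->
  0 <= kummer_coef A b s.
Proof. by move=> A0 b0; rewrite !mulr_ge0 ?invr_ge0// ltW// pochhammer_gt0. Qed.

Lemma kummer_coef_rec {R : realType} (A b : R) s : 0 < b ->
  (b + s%:R) * pseries_diffs (kummer_coef A b) s
  = (A + s%:R) * kummer_coef A b s.
Proof.
move=> b0; rewrite /pseries_diffs /kummer_coef !pochhammerS factS natrM.
have bs0 : b + s%:R != 0 by rewrite gt_eqF// ltr_pwDl.
have s0 : 1 + s%:R != 0 :> R by rewrite nat1r pnatr_eq0.
have f0 : s`!%:R != 0 :> R by rewrite pnatr_eq0 -lt0n fact_gt0.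
have p0 : pochhammer b s != 0 by rewrite gt_eqF// pochhammer_gt0.
by rewrite -nat1r; field; rewrite p0 s0 f0 bs0.
Qed.

(** Since b <= A, each ratio (A + s) / (b + s) of consecutive factors is at most
its value A / b at s = 0. *)
Lemma kummer_coef_bounded {R : realType} (A b : R) : 0 < b -> b <= A ->
  exp_bounded (kummer_coef A b).
Proof.
move=> b0 bA; have A0 : 0 < A by exact: lt_le_trans bA.
have q0 : 0 <= A / b by rewrite divr_ge0// ltW.
exists 1, (A / b); split=> // s; rewrite mul1r ger0_norm ?kummer_coef_ge0//.
rewrite ler_wpM2r ?invr_ge0//.
elim: s => [|s IH]; first by rewrite /pochhammer !big_ord0 divr1 expr0.
rewrite !pochhammerS exprSr invfM mulrACA.
apply: ler_pM => //.
- by rewrite divr_ge0// ltW// pochhammer_gt0.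
- by rewrite divr_ge0// addr_ge0// ltW.
rewrite ler_pdivrMr ?ltr_pwDl// mulrDr divfK ?gt_eqF// lerD2l.
by rewrite ler_peMl// ler_pdivlMr// mul1r.
Qed.

(** * Derivatives along coordinate directions *)

Lemma enorm_sq {R : realType} {n : nat} (x : 'rV[R]_n) :
  enorm x ^+ 2 = \sum_(i < n) x 0 i ^+ 2.
Proof. by rewrite /enorm sqr_sqrtr// sumr_ge0// => i _; exact: sqr_ge0. Qed.

(** Reduces directional derivatives in a normed space to derivatives on the real
line; the chain rule below follows from the one-variable chain rule. *)
Lemma is_derive_line {R : realType} {V : normedModType R} (f : V -> R)
    (x v : V) (df : R) :
  is_derive x v f df <-> is_derive (0 : R) 1 (fun h : R => f (h *: v + x)) df.
Proof.
have E : 'D_v f x = 'D_1 (fun h : R => f (h *: v + x)) 0.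
  rewrite /derive; set g1 := fun h => h^-1 *: _; set g2 := fun h => h^-1 *: _.
  suff -> : g1 = g2 by [].
  apply/funext => h; rewrite /g1 /g2 /=.
  by rewrite addr0 scale0r add0r [_%:A]mulr1.
split=> -[dfx <-].
  by rewrite E; apply: DeriveDef => //; exact: (derivable1P f x v).1.
by rewrite -E; apply: DeriveDef => //; apply: (derivable1P f x v).2.
Qed.

Lemma is_derive_comp {R : realType} {V : normedModType R} (f : R -> R)
    (g : V -> R) (x v : V) (a b : R) :
  is_derive (g x) 1 f a -> is_derive x v g b ->
  is_derive x v (fun y => f (g y)) (a * b).
Proof.
move=> fa /is_derive_line gb; apply/is_derive_line.
apply: (@is_derive1_comp _ f (fun h : R => g (h *: v + x))) => //.
by rewrite scale0r add0r.
Qed.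

Lemma is_derive_coord {R : realType} {n : nat} (x : 'rV[R]_n) (i j : 'I_n) :
  is_derive x (delta_mx 0 i) (fun y : 'rV[R]_n => y 0 j) (i == j)%:R.
Proof.
apply/is_derive_line.
have -> : (fun h : R => (h *: delta_mx 0 i + x : 'rV[R]_n) 0 j) =
    (fun h : R => h * (i == j)%:R + x 0 j).
  by apply/funext => h; rewrite !mxE eqxx eq_sym.
apply: is_derive_eq.
by rewrite /GRing.scale /= mulr0 add0r mulr1 addr0.
Qed.

Lemma is_derive_enorm_sq {R : realType} {n : nat} (x : 'rV[R]_n) (i : 'I_n) :
  is_derive x (delta_mx 0 i) (fun y : 'rV[R]_n => enorm y ^+ 2) (2 * x 0 i).
Proof.
have -> : (fun y : 'rV[R]_n => enorm y ^+ 2) =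
    \sum_(j < n) (fun y : 'rV[R]_n => y 0 j ^+ 2).
  by apply/funext => y; rewrite enorm_sq fct_sumE.
have h j := is_derive_coord x i j.
apply: is_derive_eq.
rewrite (bigD1 i)//= eqxx big1 ?addr0 => [|j /negbTE ji]; last first.
  by rewrite eq_sym ji !scaler0 addr0.
by rewrite /GRing.scale /= mulr1; ring.
Qed.

Lemma is_derive_radial {R : realType} {n : nat} (F : R -> R) (dF k : R)
    (x : 'rV[R]_n) (i : 'I_n) :
  is_derive (enorm x ^+ 2 / k) 1 F dF ->
  is_derive x (delta_mx 0 i) (fun y : 'rV[R]_n => F (enorm y ^+ 2 / k))
    (dF * (2 * x 0 i / k)).
Proof.
move=> hF.
apply: (@is_derive_comp _ _ F (fun y : 'rV[R]_n => enorm y ^+ 2 / k)) => //.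
have h := is_derive_enorm_sq x i.
have -> : (fun y : 'rV[R]_n => enorm y ^+ 2 / k) =
   k^-1 \*: (fun y : 'rV[R]_n => enorm y ^+ 2).
  by apply/funext => y; rewrite mulrC.
by apply: is_derive_eq; rewrite /GRing.scale /= mulrC.
Qed.

(** * Derivatives in time *)

Lemma powR_predM {R : realType} (x p : R) : 0 < x ->
  x `^ p = x `^ (p - 1) * x.
Proof.
move=> x0; rewrite -[X in _ * X]powRr1 ?ltW// -powRD ?subrK//.
by rewrite (gt_eqF x0) implybT.
Qed.

Lemma is_derive_to_T {R : realType} (T t : R) :
  is_derive t 1 (fun s => T - s) (-1).
Proof. by apply: is_derive_eq; rewrite add0r mul1r. Qed.

Lemma is_derive_powR_to_T {R : realType} (T t p : R) : t < T ->
  is_derive t 1 (fun s => (T - s) `^ p) (- (p * (T - t) `^ (p - 1))).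
Proof.
move=> tT; rewrite -[- (p * _)]mulrN1.
apply: (@is_derive_comp _ _ (fun y => y `^ p) (fun s => T - s)).
  by apply: is_derive1_powR; rewrite subr_gt0.
exact: is_derive_to_T.
Qed.

(** The time derivative of the similarity variable z = q / (4 (T - t)) is
z / (T - t). *)
Lemma is_derive_similarity {R : realType} (T t q : R) : t < T ->
  is_derive t 1 (fun s => q / (4 * (T - s))) (q / (4 * (T - t) ^+ 2)).
Proof.
move=> tT; have T0 : T - t != 0 by rewrite subr_eq0 gt_eqF.
have h := is_derive_to_T T t.
have hV := @is_deriveV R (fun s => T - s) t _ _ T0 h.
have -> : (fun s => q / (4 * (T - s))) = (q / 4) \*: (fun s => (T - s)^-1).
  by apply/funext => s; rewrite invfM mulrA.
apply: is_derive_eq.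
rewrite /GRing.scale /=; field; exact: T0.
Qed.

(** * Derivatives of self-similar functions *)

(** Arbitrary coefficients are allowed because the derivative in x_i is again of
this form, with the differentiated coefficients, up to the factor
x_i / (2 (T - t)). *)
Definition similarity_fun {R : realType} {n : nat} (a alpha T : R)
    (c : R^nat) (t : R) (x : 'rV[R]_n) : R :=
  a * (T - t) `^ alpha * psum c (enorm x ^+ 2 / (4 * (T - t))).

(** The three formulas below are the derivatives of similarity_fun for
t < T. They are named so that each can serve both as a derivative and as a
manifestly continuous function. *)
Definition similarity_dt {R : realType} {n : nat} (a alpha T : R)
    (c : R^nat) (t : R) (x : 'rV[R]_n) : R :=
  let z := enorm x ^+ 2 / (4 * (T - t)) in
  a * (T - t) `^ (alpha - 1) *
    (- alpha * psum c z + z * psum (pseries_diffs c) z).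

Definition similarity_dx {R : realType} {n : nat} (a alpha T : R)
    (c : R^nat) (i : 'I_n) (t : R) (x : 'rV[R]_n) : R :=
  similarity_fun a alpha T (pseries_diffs c) t x * (x 0 i / (2 * (T - t))).

Definition similarity_dxx {R : realType} {n : nat} (a alpha T : R)
    (c : R^nat) (i j : 'I_n) (t : R) (x : 'rV[R]_n) : R :=
  similarity_dx a alpha T (pseries_diffs c) i t x * (x 0 j / (2 * (T - t))) +
  similarity_fun a alpha T (pseries_diffs c) t x *
    ((i == j)%:R / (2 * (T - t))).

Lemma is_derive_similarity_t {R : realType} {n : nat} (a alpha T : R)
    (c : R^nat) (t : R) (x : 'rV[R]_n) : exp_bounded c -> t < T ->
  is_derive t 1 (fun s => similarity_fun a alpha T c s x)
    (similarity_dt a alpha T c t x).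
Proof.
move=> hc tT; have tau0 : T - t != 0 by rewrite subr_eq0 gt_eqF.
have hp := is_derive_powR_to_T T t alpha tT.
have hz := is_derive_similarity T t (enorm x ^+ 2) tT.
have hF := is_derive_comp _ _ _ _ _ _ (is_derive_psum c _ hc) hz.
have hM := is_deriveM (is_deriveZ a hp) hF.
apply: (is_derive_eq hM).
rewrite /similarity_dt /GRing.scale /= /GRing.scale /=.
rewrite (powR_predM _ alpha) ?subr_gt0//.
by field; exact: tau0.
Qed.

Lemma is_derive_similarity_x {R : realType} {n : nat} (a alpha T : R)
    (c : R^nat) (i : 'I_n) (t : R) (x : 'rV[R]_n) : exp_bounded c -> t < T ->
  is_derive x (delta_mx 0 i) (similarity_fun a alpha T c t)
    (similarity_dx a alpha T c i t x).
Proof.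
move=> hc tT; have tau0 : T - t != 0 by rewrite subr_eq0 gt_eqF.
have hF := is_derive_radial _ _ _ x i
  (is_derive_psum c (enorm x ^+ 2 / (4 * (T - t))) hc).
apply: (is_derive_eq (is_deriveZ (a * (T - t) `^ alpha) hF)).
rewrite /similarity_dx /similarity_fun /GRing.scale /=.
by field; exact: tau0.
Qed.

Lemma is_derive_similarity_xx {R : realType} {n : nat} (a alpha T : R)
    (c : R^nat) (i j : 'I_n) (t : R) (x : 'rV[R]_n) : exp_bounded c -> t < T ->
  is_derive x (delta_mx 0 i) (similarity_dx a alpha T c j t)
    (similarity_dxx a alpha T c i j t x).
Proof.
move=> hc tT.
have hS := is_derive_similarity_x a alpha T _ i t x (exp_bounded_diffs hc) tT.
have hj := is_deriveZ (2 * (T - t))^-1 (is_derive_coord x i j).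
have -> : similarity_dx a alpha T c j t =
    similarity_fun a alpha T (pseries_diffs c) t *
      ((2 * (T - t))^-1 \*: (fun y : 'rV[R]_n => y 0 j)).
  by apply/funext => y; rewrite /similarity_dx [y 0 j / _]mulrC.
apply: (is_derive_eq (is_deriveM hS hj)).
rewrite /similarity_dxx /GRing.scale /= /GRing.scale /=.
by ring.
Qed.

(** * Joint continuity on the strip *)

(** The derivatives agree with their closed formulas inside the strip only; as
the strip is open, this is enough to transfer continuity. *)
Lemma continuous_on_strip_eq {R : realType} {n : nat} (T : R)
    (u w : R -> 'rV[R]_n -> R) :
  (forall t x, 0 < t < T -> w t x = u t x) ->
  continuous_on_strip T w -> continuous_on_strip T u.
Proof.
move=> uw cw t x tT.
have h : \forall p \near (t, x), w p.1 p.2 = u p.1 p.2.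
  exists ([set` `]0, T[], setT).
    split; last exact: filterT.
    by apply: near_in_itvoo; rewrite in_itv.
  by move=> [s y] [/= + _]; rewrite in_itv /=; exact: uw.
rewrite /prop_for /continuous_at /= -(uw t x tT).
exact: cvg_trans (near_eq_cvg h) (cw t x tT).
Qed.

Lemma continuous_on_stripM {R : realType} {n : nat} (T : R)
    (u w : R -> 'rV[R]_n -> R) :
  continuous_on_strip T u -> continuous_on_strip T w ->
  continuous_on_strip T (fun t x => u t x * w t x).
Proof. by move=> hu hw t x tT; exact: cvgM (hu t x tT) (hw t x tT). Qed.

Lemma continuous_on_stripD {R : realType} {n : nat} (T : R)
    (u w : R -> 'rV[R]_n -> R) :
  continuous_on_strip T u -> continuous_on_strip T w ->
  continuous_on_strip T (fun t x => u t x + w t x).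
Proof. by move=> hu hw t x tT; exact: cvgD (hu t x tT) (hw t x tT). Qed.

Lemma continuous_on_strip_cst {R : realType} {n : nat} (T k : R) :
  continuous_on_strip T (fun (t : R) (x : 'rV[R]_n) => k).
Proof. by move=> t x tT; exact: cvg_cst. Qed.

Lemma continuous_on_strip_comp {R : realType} {n : nat} (T : R) (F : R -> R)
    (u : R -> 'rV[R]_n -> R) :
  (forall t x, 0 < t < T -> {for u t x, continuous F}) ->
  continuous_on_strip T u -> continuous_on_strip T (fun t x => F (u t x)).
Proof.
move=> hF hu t x tT.
apply: (@continuous_comp _ _ _ (fun p : R * 'rV[R]_n => u p.1 p.2) F).
  exact: hu.
exact: hF.
Qed.

Lemma continuous_on_strip_to_T {R : realType} {n : nat} (T : R) :
  continuous_on_strip T (fun (t : R) (x : 'rV[R]_n) => T - t).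
Proof.
move=> t x tT; apply: cvgB; first exact: cvg_cst.
exact: cvg_fst.
Qed.

Lemma continuous_on_strip_invM {R : realType} {n : nat} (T k : R) : k != 0 ->
  continuous_on_strip T (fun (t : R) (x : 'rV[R]_n) => (k * (T - t))^-1).
Proof.
move=> k0; apply: (continuous_on_strip_comp T (fun y => y^-1)); last first.
  apply: continuous_on_stripM; first exact: continuous_on_strip_cst.
  exact: continuous_on_strip_to_T.
move=> t x /andP[_ tT]; apply: inv_continuous.
by rewrite mulf_neq0// subr_eq0 gt_eqF.
Qed.

Lemma continuous_on_strip_powR {R : realType} {n : nat} (T p : R) :
  continuous_on_strip T (fun (t : R) (x : 'rV[R]_n) => (T - t) `^ p).
Proof.
apply: (continuous_on_strip_comp T (fun y => y `^ p)); last first.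
  exact: continuous_on_strip_to_T.
move=> t x /andP[_ tT]; apply/differentiable_continuous/derivable1_diffP.
have tau0 : 0 < T - t by rewrite subr_gt0.
by have [] := is_derive1_powR p tau0.
Qed.

Lemma continuous_on_strip_coord {R : realType} {n : nat} (T : R) (i : 'I_n) :
  continuous_on_strip T (fun (t : R) (x : 'rV[R]_n) => x 0 i).
Proof.
move=> t x tT.
apply: (@continuous_comp _ _ _ snd (fun y : 'rV[R]_n => y 0 i)).
  exact: cvg_snd.
exact: coord_continuous.
Qed.

Lemma continuous_on_strip_similarity {R : realType} {n : nat} (T : R) :
  continuous_on_strip T
    (fun (t : R) (x : 'rV[R]_n) => enorm x ^+ 2 / (4 * (T - t))).
Proof.
apply: continuous_on_stripM; last exact: continuous_on_strip_invM.
move=> t x tT.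
rewrite (_ : (fun p => _) = fun p : R * 'rV[R]_n => \sum_(i < n) p.2 0 i ^+ 2).
  rewrite /prop_for /continuous_at /=.
  apply: cvg_big; first exact: add_continuous.
  move=> i _.
  have h := continuous_on_strip_coord T i.
  exact: (continuous_on_stripM T _ _ h h).
by apply/funext => p; rewrite enorm_sq.
Qed.

Lemma continuous_on_strip_psum {R : realType} {n : nat} (T : R) (c : R^nat) :
  exp_bounded c -> continuous_on_strip T
    (fun (t : R) (x : 'rV[R]_n) => psum c (enorm x ^+ 2 / (4 * (T - t)))).
Proof.
move=> hc; apply: (continuous_on_strip_comp T (psum c)).
  by move=> t x _; exact: continuous_psum.
exact: continuous_on_strip_similarity.
Qed.

Lemma continuous_similarity_fun {R : realType} {n : nat} (a alpha T : R)
    (c : R^nat) : exp_bounded c ->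
  continuous_on_strip T (@similarity_fun R n a alpha T c).
Proof.
move=> hc; apply: continuous_on_stripM; last exact: continuous_on_strip_psum.
apply: continuous_on_stripM; first exact: continuous_on_strip_cst.
exact: continuous_on_strip_powR.
Qed.

Lemma continuous_similarity_dx {R : realType} {n : nat} (a alpha T : R)
    (c : R^nat) (i : 'I_n) : exp_bounded c ->
  continuous_on_strip T (similarity_dx a alpha T c i).
Proof.
move=> hc; apply: continuous_on_stripM.
  exact/continuous_similarity_fun/exp_bounded_diffs.
apply: continuous_on_stripM; first exact: continuous_on_strip_coord.
exact: continuous_on_strip_invM.
Qed.

(** * The heat equation *)

Lemma C12_similarity_fun {R : realType} {n : nat} (a alpha T : R)
    (c : R^nat) : exp_bounded c ->
  C12_on_strip T (@similarity_fun R n a alpha T c).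
Proof.
move=> hc; have hd := exp_bounded_diffs hc.
have dxE i t : t < T ->
    dx i (similarity_fun a alpha T c) t =
    similarity_dx a alpha T c i t :> ('rV[R]_n -> R).
  move=> tT; apply/funext => x.
  by have [_] := is_derive_similarity_x a alpha T c i t x hc tT.
split.
- move=> t x /andP[_ tT].
  by have [] := is_derive_similarity_t a alpha T c t x hc tT.
- move=> t x i /andP[_ tT].
  by have [] := is_derive_similarity_x a alpha T c i t x hc tT.
- move=> t x i j /andP[_ tT]; rewrite dxE//.
  by have [] := is_derive_similarity_xx a alpha T c i j t x hc tT.
- exact: continuous_similarity_fun.
- apply: (continuous_on_strip_eq T _ (similarity_dt a alpha T c)).
    move=> t x /andP[_ tT].
    by have [_] := is_derive_similarity_t a alpha T c t x hc tT.
  apply: continuous_on_stripM.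
    apply: continuous_on_stripM; first exact: continuous_on_strip_cst.
    exact: continuous_on_strip_powR.
  apply: continuous_on_stripD; apply: continuous_on_stripM.
  + exact: continuous_on_strip_cst.
  + exact: continuous_on_strip_psum.
  + exact: continuous_on_strip_similarity.
  + exact: continuous_on_strip_psum.
- move=> i; apply: (continuous_on_strip_eq T _ (similarity_dx a alpha T c i)).
    by move=> t x /andP[_ tT]; rewrite dxE.
  exact: continuous_similarity_dx.
- move=> i j.
  apply: (continuous_on_strip_eq T _ (similarity_dxx a alpha T c i j)).
    move=> t x /andP[_ tT]; rewrite {1}/dx dxE//.
    by have [_] := is_derive_similarity_xx a alpha T c i j t x hc tT.
  apply: continuous_on_stripD; apply: continuous_on_stripM.
  + exact: continuous_similarity_dx.
  + apply: continuous_on_stripM; first exact: continuous_on_strip_coord.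
    exact: continuous_on_strip_invM.
  + exact: continuous_similarity_fun.
  + apply: continuous_on_stripM; first exact: continuous_on_strip_cst.
    exact: continuous_on_strip_invM.
Qed.

(** With z = |x|^2 / (4 (T - t)) and the common factor a (T - t)^(alpha - 1)
removed, the time derivative is - alpha M + z M' and the Laplacian is
z M'' + n/2 M'; they are equal by Kummer's equation with A = - alpha and
b = n/2. *)
Lemma heat_similarity_fun {R : realType} {n : nat} (a alpha T : R)
    (c : R^nat) : exp_bounded c ->
    (forall s, (n%:R / 2 + s%:R) * pseries_diffs c s
             = (- alpha + s%:R) * c s) ->
  classical_heat_solution T (@similarity_fun R n a alpha T c).
Proof.
move=> hc rec; split; first exact: C12_similarity_fun.
move=> t x /andP[_ tT]; have tau0 : T - t != 0 by rewrite subr_eq0 gt_eqF.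
have [_] := is_derive_similarity_t a alpha T c t x hc tT.
rewrite /dt => ->; rewrite /laplacian.
have dxxE i : dx i (dx i (similarity_fun a alpha T c)) t x =
    similarity_dxx a alpha T c i i t x.
  have [_ <-] := is_derive_similarity_xx a alpha T c i i t x hc tT.
  rewrite {1}/dx; congr ('D_ _ _ _); apply/funext => y.
  by have [_] := is_derive_similarity_x a alpha T c i t y hc tT.
under eq_bigr do rewrite dxxE.
set z := enorm x ^+ 2 / (4 * (T - t)).
pose d := pseries_diffs c.
have -> : \sum_i similarity_dxx a alpha T c i i t x =
   a * (T - t) `^ (alpha - 1) *
     (z * psum (pseries_diffs d) z + n%:R / 2 * psum d z).
  under eq_bigr => i _.
    rewrite /similarity_dxx /similarity_dx /similarity_fun eqxx -/z -/d.
    rewrite [X in X + _](_ : _ = x 0 i ^+ 2 *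
      (a * (T - t) `^ alpha * psum (pseries_diffs d) z / (2 * (T - t)) ^+ 2)).
      over.
    by field; exact: tau0.
  rewrite big_split /= -mulr_suml -enorm_sq sumr_const card_ord.
  rewrite -[X in _ + X]mulr_natl (powR_predM _ alpha) ?subr_gt0//.
  have -> : enorm x ^+ 2 = z * (4 * (T - t)) by rewrite divfK// mulf_neq0.
  by field; exact: tau0.
rewrite /similarity_dt -/z.
by rewrite (psum_kummer_ode (- alpha) _ c z hc rec).
Qed.

(** * Self-similarity and blow-up *)

Lemma enorm_sqZ {R : realType} {n : nat} (k : R) (x : 'rV[R]_n) :
  enorm (k *: x) ^+ 2 = k ^+ 2 * enorm x ^+ 2.
Proof.
by rewrite !enorm_sq mulr_sumr; apply: eq_bigr => i _; rewrite mxE exprMn.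
Qed.

Lemma similarity_variableE {R : realType} {n : nat} (tau : R) (x : 'rV[R]_n) :
  0 < tau ->
  enorm (tau `^ (- (1 / 2)) *: x) ^+ 2 / 4 = enorm x ^+ 2 / (4 * tau).
Proof.
move=> tau0; rewrite enorm_sqZ powRN mul1r powR12_sqrt ?ltW// exprVn.
by rewrite sqr_sqrtr ?ltW//; field; rewrite gt_eqF.
Qed.

(** For K > 0, a negative power alpha of the distance to T is at least K / a as
soon as that distance is at most delta = (K / a)^(1/alpha), by monotonicity of
the power - alpha > 0. *)
Lemma powR_blowup {R : realType} (a alpha T : R) : 0 < a -> alpha < 0 ->
  forall B, \forall t \near T^'-, B <= a * (T - t) `^ alpha.
Proof.
move=> a0 alpha0 B.
(* The maximum with 1 keeps K / a in the domain of real powers. *)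
pose K := Num.max B 1; have K0 : 0 < K by rewrite lt_max ltr01 orbT.
pose delta := (K / a) `^ alpha^-1.
have delta0 : 0 < delta by rewrite powR_gt0// divr_gt0.
have deltaE : delta `^ alpha = K / a.
  by rewrite -powRrM mulVf ?lt_eqF// powRr1// ltW// divr_gt0.
near=> t.
have tau0 : 0 < T - t by rewrite subr_gt0; near: t; exact: nbhs_left_lt.
have taud : T - t <= delta.
  by apply: ltW; near: t; exact: nbhs_left_ltBl.
apply: (@le_trans _ _ K); first by rewrite /K le_max lexx.
rewrite mulrC -ler_pdivrMr// -deltaE -[alpha]opprK !(powRN _ (- alpha)).
rewrite lef_pV2 ?posrE; [|exact: powR_gt0|exact: powR_gt0].
by apply: ge0_ler_powR => //; rewrite ?nnegrE ?oppr_ge0 ltW.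
Unshelve. all: by end_near.
Qed.

Theorem mainTheorem5 (R : realType) (n : nat) (T a alpha : R)
    (n_ge1 : (1 <= n)%N) (T_gt0 : 0 < T) (a_gt0 : 0 < a)
    (alpha_le : alpha <= - (n%:R / 2)) :
  [/\ forall (t : R) (x : 'rV[R]_n), 0 < t < T ->
        cvgn (series (u_series alpha T t x)),
      selfsimilar_typeII_solution alpha T (@u_alpha R n a alpha T) &
      blows_up_at T (@u_alpha R n a alpha T)].
Proof.
have b0 : 0 < n%:R / 2 :> R by rewrite divr_gt0// ltr0n.
have bA : n%:R / 2 <= - alpha by rewrite lerNr.
have A0 : 0 < - alpha by exact: lt_le_trans bA.
pose c := kummer_coef (- alpha) (n%:R / 2).
have hc : exp_bounded c by exact: kummer_coef_bounded.
have c0 : c 0%N = 1 by rewrite /c /kummer_coef /pochhammer !big_ord0 !divr1.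
have cge s : 0 <= c s by exact: kummer_coef_ge0.
split.
- by move=> t x _; exact: (exp_bounded_cvg (enorm x ^+ 2 / (4 * (T - t))) hc).
- split.
    apply: (heat_similarity_fun a alpha T c hc) => s.
    exact: kummer_coef_rec.
  exists (fun y => a * psum c (enorm y ^+ 2 / 4)); split.
  + move=> y; rewrite mulr_gt0//; apply: lt_le_trans ltr01 _.
    by apply: psum_ge1 => //; rewrite divr_ge0// sqr_ge0.
  + by move=> x y xy; rewrite xy.
  + move=> t x /andP[_ tT]; rewrite similarity_variableE ?subr_gt0//.
    by rewrite mulrCA mulrA.
- apply/cvgeyPge => B.
  have alpha0 : alpha < 0 by rewrite -oppr_gt0.
  near=> t.
  have tT : t < T by near: t; exact: nbhs_left_lt.
  (* The supremum is bounded below by the value at the origin. *)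
  apply: (@le_trans _ _ `|u_alpha a alpha T t (0 : 'rV[R]_n)|%:E); last first.
    by apply: ereal_sup_ubound; exists 0.
  rewrite lee_fin; apply: le_trans (ler_norm _).
  apply: (@le_trans _ _ (a * (T - t) `^ alpha)).
    by near: t; exact: powR_blowup.
  apply: ler_peMr; first by rewrite mulr_ge0 ?powR_ge0// ltW.
  apply: (psum_ge1 c (enorm (0 : 'rV[R]_n) ^+ 2 / (4 * (T - t))) hc) => //.
  by rewrite divr_ge0 ?sqr_ge0// mulr_ge0// subr_ge0 ltW.
Unshelve. all: by end_near.
Qed.
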